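(* Consider Algorithm FoBa-gdt with parameter $\epsilon$. Let $s$ be a positive integer such that $$(s-\bar k)>(\bar k+1)\left[\left(\sqrt{\frac{\rho_+(s)}{\rho_-(s)}}+1\right)\frac{2\rho_+(1)}{\rho_-(s)}\right]^2,$$ and take $\epsilon>\frac{2\sqrt2\,\rho_+(1)}{\rho_-(s)}\|\nabla Q(\bar\beta)\|_\infty$. Then the algorithm terminates at some $k\le s-\bar k$.
   Context: Let $Q:\mathbb{R}^d\to\mathbb{R}$ be convex and continuously differentiable. $e_j$ is the $j$-th standard basis vector, $\mathrm{supp}(\beta)=\{j:\beta_j\ne0\}$, $\|\beta\|_0=|\mathrm{supp}(\beta)|$, $\|\cdot\|$ is the Euclidean norm, $A-B$ is set difference, and $v_S$ is $v$ restricted to the coordinates in $S$. For $F\subseteq\{1,\dots,d\}$, $\hat\beta(F)$ denotes a minimizer of $Q$ over $\{\beta:\mathrm{supp}(\beta)\subseteq F\}$ (assumed to exist). For a positive integer $s$, the restricted strong convexity constants $\rho_-(s),\rho_+(s)>0$ are constants such that for all $\beta,\beta'\in\mathbb{R}^d$ with $\|\beta'-\beta\|_0\le s$: $\frac{\rho_-(s)}{2}\|\beta'-\beta\|^2\le Q(\beta')-Q(\beta)-\langle\nabla Q(\beta),\beta'-\beta\rangle\le\frac{\rho_+(s)}{2}\|\beta'-\beta\|^2.$ $\bar\beta$ is a solution of $\min_\beta Q(\beta)$ subject to $\|\beta\|_0\le\bar k$, $\bar F=\mathrm{supp}(\bar\beta)$ and $\bar k=|\bar F|$. Algorithm FoBa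 has two variants: FoBa-obj (parameter $\delta>0$) and FoBa-gdt (parameter $\epsilon>0$). Initialize $F^{(0)}=\emptyset$, $\beta^{(0)}=0$, $k=0$, and repeat the following iteration. (1) Stopping test: FoBa-obj stops if $Q(\beta^{(k)})-\min_{\alpha\in\mathbb{R},\,j\notin F^{(k)}}Q(\beta^{(k)}+\alpha e_j)<\delta$; FoBa-gdt stops if $\|\nabla Q(\beta^{(k)})\|_\infty<\epsilon$. On stopping the output is $\beta^{(k)}$ with support $F^{(k)}$, and the algorithm is said to terminate at $k$. (2) Forward step: FoBa-obj picks $i^{(k)}\in\arg\min_{i\notin F^{(k)}}\min_\alpha Q(\beta^{(k)}+\alpha e_i)$; FoBa-gdt picks $i^{(k)}\in\arg\max_{i\notin F^{(k)}}|\nabla Q(\beta^{(k)})_i|$. Set $F^{(k+1)}=F^{(k)}\cup\{i^{(k)}\}$, $\beta^{(k+1)}=\hat\beta(F^{(k+1)})$, $\delta^{(k+1)}=Q(\beta^{(k)})-Q(\beta^{(k+1)})$, $k\leftarrow k+1$. (3) Backward step: repeat — if $F^{(k)}=\emptyset$ or $\min_{i\in F^{(k)}}Q(\beta^{(k)}-\beta^{(k)}_ie_i)-Q(\beta^{(k)})\ge\delta^{(k)}/2$, leave the backward step; otherwise pick $j\in\arg\min_{i\in F^{(k)}}Q(\beta^{(k)}-\beta^{(k)}_ie_i)$, set $F^{(k-1)}=F^{(k)}-\{j\}$, $\beta^{(k-1)}=\hat\beta(F^{(k-1)})$, $k\leftarrow k-1$ (where $\delta^{(k-1)}$ is the value recorded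 at the most recent forward step producing index $k-1$). Thus $|F^{(k)}|=k$ always. ''At the beginning of an iteration'' means the state just before a stopping test. *)

(* Defs.v *)
From Stdlib Require Import Reals.
From mathcomp Require Import all_boot.

Set Implicit Arguments.
Unset Strict Implicit.
Unset Printing Implicit Defensive.

Local Open Scope R_scope.

Definition vec (d : nat) := 'I_d -> R.

Definition vzero {d} : vec d := fun _ => 0.
Definition vadd {d} (u v : vec d) : vec d := fun i => u i + v i.
Definition vsub {d} (u v : vec d) : vec d := fun i => u i - v i.
Definition vscale {d} (a : R) (v : vec d) : vec d := fun i => a * v i.
Definition ej {d} (j : 'I_d) : vec d := fun i => if i == j then 1 else 0.

Definition dot {d} (u v : vec d) : R := \big[Rplus/0]_(i < d) (u i * v i).
Definition sqnorm {d} (v : vec d) : R := dot v v.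
Definition norm2 {d} (v : vec d) : R := sqrt (sqnorm v).
Definition infnorm {d} (v : vec d) : R := \big[Rmax/0]_(i < d) Rabs (v i).

Definition nzb (x : R) : bool := if Req_EM_T x 0 then false else true.
Definition supp {d} (v : vec d) : {set 'I_d} := [set j | nzb (v j)].
Definition l0 {d} (v : vec d) : nat := #|supp v|.

Definition convex {d} (Q : vec d -> R) : Prop :=
  forall (x y : vec d) (t : R), 0 <= t <= 1 ->
    Q (vadd (vscale t x) (vscale (1 - t) y)) <= t * Q x + (1 - t) * Q y.

(* g is the gradient: all partial derivatives exist and equal g, and g is
   continuous (this is exactly "Q is continuously differentiable"). *)
Definition is_C1_gradient {d} (Q : vec d -> R) (g : vec d -> vec d) : Prop :=
  (forall (b : vec d) (j : 'I_d),
      derivable_pt_lim (fun t => Q (vadd b (vscale t (ej j)))) 0 (g b j)) /\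
  (forall (b : vec d) (eps : R), 0 < eps -> exists del, 0 < del /\
      forall b' : vec d, norm2 (vsub b' b) < del -> norm2 (vsub (g b') (g b)) < eps).

Definition RSC {d} (Q : vec d -> R) (g : vec d -> vec d) (s : nat) (rm rp : R) : Prop :=
  0 < rm /\ 0 < rp /\
  forall b b' : vec d, (l0 (vsub b' b) <= s)%N ->
    rm / 2 * sqnorm (vsub b' b) <= Q b' - Q b - dot (g b) (vsub b' b)
    <= rp / 2 * sqnorm (vsub b' b).

Definition restricted_min {d} (Q : vec d -> R) (F : {set 'I_d}) (b : vec d) : Prop :=
  supp b \subset F /\
  forall b' : vec d, supp b' \subset F -> Q b <= Q b'.

(* State of FoBa: current support F^(k) (k = #|F|), current beta^(k), and the
   recorded values delta^(m) (delta m = value recorded at the most recent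
   forward step producing index m). *)
Record state (d : nat) := State {
  sF : {set 'I_d};
  sbeta : vec d;
  sdelta : nat -> R }.

Definition init_state (d : nat) : state d := State set0 vzero (fun _ => 0).

Definition gdt_stop {d} (g : vec d -> vec d) (eps : R) (st : state d) : Prop :=
  infnorm (g (sbeta st)) < eps.

(* FoBa-gdt forward step (any tie-breaking, any choice of minimizer) *)
Definition gdt_forward {d} (Q : vec d -> R) (g : vec d -> vec d)
    (st st1 : state d) : Prop :=
  exists i : 'I_d,
    i \notin sF st /\
    (forall i' : 'I_d, i' \notin sF st -> Rabs (g (sbeta st) i') <= Rabs (g (sbeta st) i)) /\
    sF st1 = i |: sF st /\
    restricted_min Q (sF st1) (sbeta st1) /\
    sdelta st1 = (fun m => if m == #|sF st1| then Q (sbeta st) - Q (sbeta st1)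
                           else sdelta st m).

Definition Qdrop {d} (Q : vec d -> R) (b : vec d) (i : 'I_d) : R :=
  Q (vsub b (vscale (b i) (ej i))).

Inductive foba_backward {d} (Q : vec d -> R) : state d -> state d -> Prop :=
| bwd_exit : forall st,
    (sF st = set0 \/
     forall i, i \in sF st -> sdelta st #|sF st| / 2 <= Qdrop Q (sbeta st) i - Q (sbeta st)) ->
    foba_backward Q st st
| bwd_step : forall st j st1 st2,
    j \in sF st ->
    (forall i, i \in sF st -> Qdrop Q (sbeta st) j <= Qdrop Q (sbeta st) i) ->
    Qdrop Q (sbeta st) j - Q (sbeta st) < sdelta st #|sF st| / 2 ->
    sF st1 = sF st :\ j ->
    restricted_min Q (sF st1) (sbeta st1) ->
    sdelta st1 = sdelta st ->
    foba_backward Q st1 st2 ->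
    foba_backward Q st st2.

Definition gdt_iter {d} (Q : vec d -> R) (g : vec d -> vec d) (eps : R)
    (st st' : state d) : Prop :=
  ~ gdt_stop g eps st /\
  exists st1, gdt_forward Q g st st1 /\ foba_backward Q st1 st'.

Inductive gdt_reachable {d} (Q : vec d -> R) (g : vec d -> vec d) (eps : R)
  : state d -> Prop :=
| reach_init : gdt_reachable Q g eps (init_state d)
| reach_step : forall st st', gdt_reachable Q g eps st ->
    gdt_iter Q g eps st st' -> gdt_reachable Q g eps st'.

(* Main.v *)
(** Every backward exit forces [b_j^2 >= delta / rp_1] on the current support
    [F], and every forward step gains [delta >= G^2 / (2 rp_1)], where
    [G >= eps] is the largest gradient entry outside the support.  Suppose an
    iteration starts at level [s - kbar] for the first time, with iterate [b];
    then [b] has just been produced by a forward step from some [b0].  Let [b']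
    minimise [Q] over the union of the supports of [b] and [bbar].  The lower
    bound on the entries of [b] gives [Q bbar <= Q b], hence
    [|b - bbar| <= (1 + sqrt (rp_s / rm_s)) |b - b'|]; the same bound combined
    with strong convexity between [b0] and [b'] gives a lower bound of
    [|b - bbar|] in terms of [|b - b'|], and the choice of [s] makes the two
    incompatible.  So the level always stays below [s - kbar].

    For termination, let [q_m] be the value of [Q] when level [m] was last
    visited, with [q_m = q_k] beyond the current level [k].  The potential
    [sum_(m <= d) 2^(d - m) q_m] drops by at least [eps^2 / (2 rp_1)] at every
    forward step.  A backward step to level [k - 1] moves up [q_m], [m >= k],
    by at most as much as it moves down [q_(k-1)], whose weight dominates
    theirs, so the potential does not increase. *)

Require Import Defs.
From Stdlib Require Import Reals Lra FunctionalExtensionality.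
From HB Require Import structures.
From mathcomp Require Import all_boot zify.

Set Implicit Arguments.
Unset Strict Implicit.
Unset Printing Implicit Defensive.

Local Open Scope R_scope.

HB.instance Definition _ := Monoid.isComLaw.Build R 0 Rplus
  (fun x y z => esym (Rplus_assoc x y z)) Rplus_comm Rplus_0_l.

(** * Finite sums and maxima of reals *)

Lemma Rsum_le (I : finType) (f h : I -> R) :
  (forall i, f i <= h i) -> \big[Rplus/0]_i f i <= \big[Rplus/0]_i h i.
Proof.
by move=> le_fh; apply: (big_ind2 Rle) => // [|*]; [lra | exact: Rplus_le_compat].
Qed.

Lemma Rsum_scale (I : finType) (a : R) (f : I -> R) :
  \big[Rplus/0]_i (a * f i) = a * \big[Rplus/0]_i f i.
Proof. by elim/big_rec2: _ => [|i x y _ ->]; lra. Qed.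

Lemma Rsum_indicator (I : finType) (A : {set I}) (a : R) :
  \big[Rplus/0]_i (if i \in A then a else 0) = INR #|A| * a.
Proof.
rewrite -big_mkcond big_const; elim: #|A| => [|n IHn] /=; first lra.
by rewrite IHn -/(INR n.+1) S_INR; lra.
Qed.

Lemma seq_Rargmax (T : eqType) (f : T -> R) (x0 : T) (r : seq T) :
  exists2 x, x \in x0 :: r & forall y, y \in x0 :: r -> f y <= f x.
Proof.
elim: r x0 => [|x1 r IHr] x0.
  by exists x0; rewrite ?mem_head // => y; rewrite inE => /eqP->; lra.
have [x xr xmax] := IHr x1.
have [le_x|lt_x] := Rle_lt_dec (f x0) (f x).
  exists x; first by rewrite inE xr orbT.
  by move=> y; rewrite inE => /orP[/eqP->|/xmax].
exists x0; first by rewrite mem_head.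
by move=> y; rewrite inE => /orP[/eqP->|/xmax]; lra.
Qed.

Lemma set_Rargmax (T : finType) (f : T -> R) (A : {set T}) (x0 : T) :
  x0 \in A -> exists2 x, x \in A & forall y, y \in A -> f y <= f x.
Proof.
move=> Ax0; have: x0 \in enum A by rewrite mem_enum.
case E: (enum A) => [//|a r] _.
have [x xr xmax] := seq_Rargmax f a r.
exists x; first by rewrite -mem_enum E.
by move=> y Ay; apply: xmax; rewrite -E mem_enum.
Qed.

(** * Sparse vectors *)

Section Vectors.

Variable d : nat.
Implicit Types (u v b : vec d) (A F : {set 'I_d}).

Lemma infnorm_ge v i : Rabs (v i) <= infnorm v.
Proof.
rewrite /infnorm; have: i \in index_enum 'I_d by rewrite mem_index_enum.
elim: (index_enum _) => // j r IHr; rewrite inE big_cons.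
case/orP=> [/eqP <-|/IHr le_i]; first exact: Rmax_l.
exact: Rle_trans le_i (Rmax_r _ _).
Qed.

Lemma infnorm_ge0 v : 0 <= infnorm v.
Proof.
rewrite /infnorm; elim: (index_enum _) => [|j r IHr]; rewrite ?big_nil ?big_cons.
  exact: Rle_refl.
exact: Rle_trans IHr (Rmax_r _ _).
Qed.

(** The maximum over no entries is 0, hence the condition [0 < e]. *)
Lemma infnorm_lt v e :
  0 < e -> (forall i, Rabs (v i) < e) -> infnorm v < e.
Proof.
by rewrite /infnorm => e0 lt_e; elim/big_rec: _ => // i x _ ltx; exact: Rmax_lub_lt.
Qed.

Lemma notin_supp v j : j \notin supp v -> v j = 0.
Proof. by rewrite inE /nzb; case: Req_EM_T. Qed.

Lemma subset_supp v A : (forall j, j \notin A -> v j = 0) -> supp v \subset A.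
Proof.
move=> v0; apply/subsetP => j; apply: contraTT => /v0 vj.
by rewrite inE /nzb vj; case: Req_EM_T.
Qed.

Lemma supp_outside v A j : supp v \subset A -> j \notin A -> v j = 0.
Proof. by move=> /subsetP sA jA; apply: notin_supp; apply: contra jA => /sA. Qed.

Lemma l0_vsub_le u v A n :
  supp u \subset A -> supp v \subset A -> (#|A| <= n)%N ->
  (l0 (vsub u v) <= n)%N.
Proof.
move=> sA tA; apply: leq_trans; apply: subset_leq_card; apply: subset_supp => j jA.
by rewrite /vsub (supp_outside sA jA) (supp_outside tA jA); lra.
Qed.

Lemma sqnorm_ge_card v A a :
  (forall j, j \in A -> a <= v j * v j) -> INR #|A| * a <= sqnorm v.
Proof.
move=> ge_a; rewrite -Rsum_indicator; apply: Rsum_le => j.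
by case: ifP => [/ge_a //|_]; nra.
Qed.

Lemma dot_eq0 u v : (forall j, u j = 0 \/ v j = 0) -> dot u v = 0.
Proof.
by move=> uv0; rewrite /dot big1 // => j _; case: (uv0 j) => ->; lra.
Qed.

Lemma dot_single (x : R) v j u :
  (forall i, u i = x * ej j i) -> dot v u = x * v j.
Proof.
move=> uE; rewrite /dot (bigD1 j) //= big1 => [|i /negPf ij].
  by rewrite uE /ej eqxx; lra.
by rewrite uE /ej ij; lra.
Qed.

Lemma l0_single (x : R) j u : (forall i, u i = x * ej j i) -> (l0 u <= 1)%N.
Proof.
move=> uE; rewrite -(cards1 j); apply: subset_leq_card; apply: subset_supp => i.
by rewrite inE uE /ej => /negPf->; lra.
Qed.

(** Lets the linear plus quadratic part of strong convexity be bounded below one coordinate at a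
    time. *)
Lemma dot_sqnorm_ge (r : R) u v (f : 'I_d -> R) :
  (forall j, f j <= u j * v j + r * (v j * v j)) ->
  \big[Rplus/0]_j f j <= dot u v + r * sqnorm v.
Proof.
by move=> le_f; rewrite -Rsum_scale -big_split; apply: Rsum_le.
Qed.

(** In each coordinate the two sides differ by (t x + y)^2 / t. The weight [t] is left free, to be
    matched later to the ratio of the two distances to [b]. *)
Lemma sqnorm_triangle (t : R) u v b :
  0 < t ->
  sqnorm (vsub u v) <=
  (1 + t) * sqnorm (vsub u b) + (1 + / t) * sqnorm (vsub v b).
Proof.
move=> t0; rewrite -!Rsum_scale -big_split; apply: Rsum_le => j.
rewrite /vsub /=; set x := u j - b j; set y := v j - b j.
have -> : u j - v j = x - y by rewrite /x /y; lra.
have sqE : (1 + t) * (x * x) + (1 + / t) * (y * y) - (x - y) * (x - y) =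
           / t * ((t * x + y) * (t * x + y)) by field; lra.
have t'0 := Rinv_0_lt_compat _ t0.
suff: 0 <= / t * ((t * x + y) * (t * x + y)) by lra.
by apply: Rmult_le_pos; [lra | exact: Rle_0_sqr].
Qed.

End Vectors.

(** * Restricted strong convexity *)

Section RestrictedConvexity.

Variables (d : nat) (Q : vec d -> R) (g : vec d -> vec d).
Variables (s : nat) (r P r1 p : R).
Hypotheses (HRSCs : RSC Q g s r P) (HRSC1 : RSC Q g 1 r1 p).
Implicit Types (b u v : vec d) (F A : {set 'I_d}).

Lemma RSC1_upper b b' j x :
  (forall i, vsub b' b i = x * ej j i) ->
  Q b' <= Q b + x * g b j + p / 2 * (x * x).
Proof.
move=> E; have [_ [_ /(_ b b' (l0_single E)) [_]]] := HRSC1.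
rewrite (dot_single _ E) /sqnorm (dot_single _ E) E /ej eqxx; lra.
Qed.

(** Compare the lower bound at sparsity [s] with the upper bound at sparsity 1 on the pair 0, e_j;
    the index [j] ensures that a coordinate exists. *)
Lemma RSC_const_le (j : 'I_d) : (0 < s)%N -> r <= p.
Proof.
move=> s0.
have E i : vsub (ej j) vzero i = 1 * ej j i by rewrite /vsub /vzero; lra.
have := RSC1_upper E.
have [_ [_ /(_ vzero (ej j))]] := HRSCs.
case; first exact: leq_trans (l0_single E) s0.
rewrite (dot_single _ E) /sqnorm (dot_single _ E) E /ej eqxx; lra.
Qed.

(** Otherwise the move [- g b j / p] along e_j, which minimises the quadratic upper bound, would
    stay supported in [F] and lower [Q]. *)
Lemma restricted_min_grad0 F b j :
  restricted_min Q F b -> j \in F -> g b j = 0.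
Proof.
move=> [bF bmin] jF; have [_ [p0 _]] := HRSC1.
pose x := - g b j / p.
have E i : vsub (vadd b (vscale x (ej j))) b i = x * ej j i.
  by rewrite /vsub /vadd /vscale; lra.
have le1 := RSC1_upper E.
have le2 : Q b <= Q (vadd b (vscale x (ej j))).
  apply: bmin; apply: subset_supp => i iF.
  rewrite /vadd /vscale (supp_outside bF iF) /ej.
  by case: eqP => [ij|_]; [rewrite ij jF in iF | lra].
have eqx : x * g b j + p / 2 * (x * x) = - (g b j * g b j) / (2 * p).
  by rewrite /x; field; lra.
have eqy : g b j * g b j = 2 * p * - (- (g b j * g b j) / (2 * p)) by field; lra.
nra.
Qed.

(** The linear term vanishes: the gradient is zero on [F] and b' - b is zero off [F]. *)
Lemma restricted_min_RSC F b b' :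
  restricted_min Q F b -> supp b' \subset F -> (#|F| <= s)%N ->
  r / 2 * sqnorm (vsub b' b) <= Q b' - Q b <= P / 2 * sqnorm (vsub b' b).
Proof.
move=> bmin b'F sF; have [bF _] := bmin.
have [_ [_ /(_ b b' (l0_vsub_le b'F bF sF))]] := HRSCs.
rewrite dot_eq0 ?Rminus_0_r // => j.
case: (boolP (j \in F)) => jF; first by left; exact: restricted_min_grad0 bmin jF.
by right; rewrite /vsub (supp_outside b'F jF) (supp_outside bF jF); lra.
Qed.

Lemma Qdrop_upper F b j :
  restricted_min Q F b -> j \in F -> Qdrop Q b j - Q b <= p / 2 * (b j * b j).
Proof.
move=> bmin jF.
have E i : vsub (vsub b (vscale (b j) (ej j))) b i = - b j * ej j i.
  by rewrite /vsub /vscale; lra.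
have := RSC1_upper E; rewrite (restricted_min_grad0 bmin jF) /Qdrop; lra.
Qed.

Lemma forward_gain F b b' i :
  supp b \subset F -> restricted_min Q (i |: F) b' ->
  g b i * g b i / (2 * p) <= Q b - Q b'.
Proof.
move=> bF [_ b'min]; have [_ [p0 _]] := HRSC1.
pose x := - g b i / p.
have E j : vsub (vadd b (vscale x (ej i))) b j = x * ej i j.
  by rewrite /vsub /vadd /vscale; lra.
have le1 := RSC1_upper E.
have le2 : Q b' <= Q (vadd b (vscale x (ej i))).
  apply: b'min; apply: subset_supp => j; rewrite in_setU1 negb_or => /andP[ji jF].
  by rewrite /vadd /vscale (supp_outside bF jF) /ej (negPf ji); lra.
have eqx : x * g b i + p / 2 * (x * x) = - (g b i * g b i / (2 * p)).
  by rewrite /x; field; lra.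
lra.
Qed.

(* Young's inequality in each coordinate of [A :\: F]. *)
Lemma greedy_gap F A b b' G :
  restricted_min Q F b -> F \subset A -> supp b' \subset A -> (#|A| <= s)%N ->
  (forall j, j \notin F -> Rabs (g b j) <= G) ->
  Q b - Q b' <= INR #|A :\: F| * (G * G / (2 * r)).
Proof.
move=> bmin FA b'A sA leG; have [bF _] := bmin.
have bA := subset_trans bF FA.
have [r0 [_ /(_ b b' (l0_vsub_le b'A bA sA)) [lb _]]] := HRSCs.
have := @dot_sqnorm_ge d (r / 2) (g b) (vsub b' b)
  (fun j => if j \in A :\: F then - (G * G / (2 * r)) else 0).
rewrite Rsum_indicator => /(_ _) lb2.
have {}lb2 : INR #|A :\: F| * - (G * G / (2 * r)) <=
  dot (g b) (vsub b' b) + r / 2 * sqnorm (vsub b' b); last lra.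
apply: lb2 => j; rewrite in_setD.
set y := vsub b' b j.
case: (boolP (j \in F)) => jF /=.
  by rewrite (restricted_min_grad0 bmin jF); nra.
case: (boolP (j \in A)) => jA; last first.
  by rewrite /y /vsub (supp_outside b'A jA) (supp_outside bA jA); lra.
have le_g : g b j * g b j <= G * G.
  rewrite -[g b j * _]/(Rsqr (g b j)) Rsqr_abs; apply: Rsqr_incr_1 (leG _ jF) _ _.
    exact: Rabs_pos.
  exact: Rle_trans (Rabs_pos _) (leG _ jF).
have eqy : g b j * y + r / 2 * (y * y) =
    / (2 * r) * ((g b j + r * y) * (g b j + r * y)) - / (2 * r) * (g b j * g b j).
  by field; lra.
have i0 : 0 < / (2 * r) by apply: Rinv_0_lt_compat; lra.
have le1 := Rmult_le_compat_l _ _ _ (Rlt_le _ _ i0) le_g.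
have le2 := Rmult_le_pos _ _ (Rlt_le _ _ i0) (Rle_0_sqr (g b j + r * y)).
by rewrite eqy /Rdiv; rewrite /Rsqr in le2; lra.
Qed.

(* The cross term is absorbed in each coordinate: on [F :\: B] the entries of
   [b] are large, and the gradient at [bbar] vanishes on [B]. *)
Lemma large_entries_value_ge F B b bbar a :
  restricted_min Q B bbar -> supp b \subset F -> (#|F :|: B| <= s)%N ->
  (forall j, j \in F -> a <= Rabs (b j)) ->
  (forall j, Rabs (g bbar j) <= r / 2 * a) ->
  Q bbar <= Q b.
Proof.
move=> bbmin bF sFB large small; have [bbB _] := bbmin.
have sub1 := subset_trans bF (subsetUl F B).
have sub2 := subset_trans bbB (subsetUr F B).
have [r0 [_ /(_ bbar b (l0_vsub_le sub1 sub2 sFB)) [lb _]]] := HRSCs.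
suff: 0 <= dot (g bbar) (vsub b bbar) + r / 2 * sqnorm (vsub b bbar) by lra.
have <- : \big[Rplus/0]_(j < d) 0 = 0 by rewrite big1.
apply: dot_sqnorm_ge => j.
case: (boolP (j \in B)) => jB.
  by rewrite (restricted_min_grad0 bbmin jB); nra.
rewrite /vsub (supp_outside bbB jB) Rminus_0_r.
case: (boolP (j \in F)) => jF; last by rewrite (supp_outside bF jF); lra.
have l1 := large _ jF; have s1 := small j.
have n1 := Rabs_pos (b j).
have -> : b j * b j = Rabs (b j) * Rabs (b j) by rewrite -Rabs_mult Rabs_pos_eq //; nra.
have : - (g bbar j * b j) <= Rabs (g bbar j) * Rabs (b j).
  by rewrite -Rabs_mult -Rabs_Ropp; exact: Rle_abs.
have le1 : r / 2 * a <= r / 2 * Rabs (b j) by apply: Rmult_le_compat_l; lra.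
have := Rmult_le_compat_r _ _ _ n1 (Rle_trans _ _ _ s1 le1); lra.
Qed.

End RestrictedConvexity.

(** * The termination potential *)

(* Total weight [sum_(k <= m <= d) 2^(d - m)] of the levels from [k] on. *)
Definition tail_weight (d k : nat) : R := 2 ^ (d.+1 - k)%N - 1.

Lemma tail_weightS d k :
  (k <= d)%N -> tail_weight d k = 2 * tail_weight d k.+1 + 1.
Proof. by move=> kd; rewrite /tail_weight subSS subSn //=; lra. Qed.

Lemma tail_weight_ge0 d k : 0 <= tail_weight d k.
Proof.
by rewrite /tail_weight; have := pow_R1_Rle 2 (d.+1 - k); lra.
Qed.

Lemma tail_weight_le d k : tail_weight d k <= tail_weight d 0.
Proof.
have := @Rle_pow 2 (d.+1 - k) (d.+1 - 0); rewrite /tail_weight => le_pow.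
suff: 2 ^ (d.+1 - k) <= 2 ^ (d.+1 - 0) by lra.
by apply: le_pow; [lra | lia].
Qed.

(* [chain d c D k x phi]: some [q_0, ..., q_k = x] satisfy
   [c <= D m <= q_(m-1) - q_m] for [0 < m <= k], and [phi] is the potential
   [sum_(m < k) 2^(d - m) q_m + tail_weight d k * q_k], written by an Abel
   summation. *)
Inductive chain (d : nat) (c : R) (D : nat -> R) : nat -> R -> R -> Prop :=
| chain0 x : chain d c D 0 x (tail_weight d 0 * x)
| chainS k x y phi : chain d c D k x phi -> D k.+1 <= x - y -> c <= D k.+1 ->
    chain d c D k.+1 y (phi - tail_weight d k.+1 * (x - y)).

Section Chain.

Variables (d : nat) (c : R).
Implicit Types (D : nat -> R).

(** A forward step to level k + 1 overwrites only [D k.+1], so the chain up to [k] survives. *)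
Lemma eq_chain D D' k x phi :
  (forall m, (m <= k)%N -> D' m = D m) -> chain d c D k x phi ->
  chain d c D' k x phi.
Proof.
move=> eqD ch; elim: ch eqD => {k x phi} [x _|k x y phi _ IH le1 le2 eqD].
  exact: chain0.
apply: chainS; rewrite ?eqD //; apply: IH => m mk; apply: eqD; exact: leqW.
Qed.

(** Only the last gap changes, and it widens. *)
Lemma chain_lower D k x y phi :
  chain d c D k x phi -> y <= x ->
  chain d c D k y (phi - tail_weight d k * (x - y)).
Proof.
case=> {k x phi} [x|k x z phi ch le1 le2] le_y.
  have -> : tail_weight d 0 * x - tail_weight d 0 * (x - y) = tail_weight d 0 * y by lra.
  exact: chain0.
have -> : phi - tail_weight d k.+1 * (x - z) - tail_weight d k.+1 * (z - y) =
          phi - tail_weight d k.+1 * (x - y) by lra.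
by apply: chainS => //; lra.
Qed.

(** Let x0 be the value at level [k]. Since [D k.+1] is at most x0 - x, the new value keeps more
    than half of the gap: x0 - y > (x0 - x) / 2. The weight at level [k] is more than twice the one
    at k + 1, which pays for the lost half. *)
Lemma chain_backward D k x y phi :
  0 < c -> (k <= d)%N -> chain d c D k.+1 x phi -> y < x + D k.+1 / 2 ->
  exists2 phi', chain d c D k y phi' & phi' <= phi.
Proof.
move=> c0 kd ch lt_y; inversion ch as [|k' x0 y' phi0 ch0 le1 le2]; subst.
have le_y : y <= x0 by lra.
exists (phi0 - tail_weight d k * (x0 - y)); first exact: chain_lower.
have := tail_weight_ge0 d k.+1; rewrite (tail_weightS kd) => w0.
nra.
Qed.

(** The values q_m decrease along the chain, so each is at least the last one. *)
Lemma chain_ge D k x phi :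
  0 <= c -> chain d c D k x phi -> tail_weight d 0 * x <= phi.
Proof.
move=> c0; elim=> {k x phi} [x|k x y phi _ IH le1 le2]; first lra.
have := tail_weight_le d k.+1; nra.
Qed.

End Chain.

(** * Runs of the algorithm *)

Section Runs.

Variables (d : nat) (Q : vec d -> R) (g : vec d -> vec d) (eps : R).
Implicit Types (st : state d).

Notation optimal st := (restricted_min Q (sF st) (sbeta st)).

Lemma supp_drop (F : {set 'I_d}) (b : vec d) j :
  supp b \subset F -> supp (vsub b (vscale (b j) (ej j))) \subset F :\ j.
Proof.
move=> bF; apply: subset_supp => i; rewrite in_setD1 negb_and negbK.
rewrite /vsub /vscale /ej; case: eqP => [->|_] //= iF; first lra.
by rewrite (supp_outside bF iF); lra.
Qed.

Lemma backward_optimal st st' :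
  foba_backward Q st st' -> optimal st -> optimal st'.
Proof. by elim=> // {}st j st1 st2 _ _ _ _ opt1 _ _ IH _; exact: IH. Qed.

Lemma backward_card st st' :
  foba_backward Q st st' -> (#|sF st'| <= #|sF st|)%N.
Proof.
elim=> // {}st j st1 st2 _ _ _ F1 _ _ _ le21; apply: leq_trans le21 _.
by rewrite F1 subset_leq_card // subD1set.
Qed.

Lemma backward_potential c st st' phi :
  0 < c -> foba_backward Q st st' -> optimal st ->
  chain d c (sdelta st) #|sF st| (Q (sbeta st)) phi ->
  exists2 phi', chain d c (sdelta st') #|sF st'| (Q (sbeta st')) phi' & phi' <= phi.
Proof.
move=> c0 bwd; elim: bwd phi => {st st'} [st _|st j st1 st2 jF jmin lt_drop F1 min1 D1 _ IH] phi.
  by exists phi; last exact: Rle_refl.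
move=> [bF _] ch.
have cardF : #|sF st| = #|sF st1|.+1 by rewrite F1 (cardsD1 j) jF.
(* The truncated vector is feasible for the smaller support, so the bound on its rise carries over
   to the re-optimised value. *)
have le1 : Q (sbeta st1) <= Qdrop Q (sbeta st) j.
  by apply: min1.2; rewrite F1; exact: supp_drop.
have kd : (#|sF st1| <= d)%N by rewrite -[X in (_ <= X)%N]card_ord max_card.
rewrite cardF in ch lt_drop.
have [|phi1 ch1 le_phi1] := chain_backward (y := Q (sbeta st1)) c0 kd ch; first lra.
rewrite -D1 in ch1; have [phi2 ch2 le_phi2] := IH _ min1 ch1.
by exists phi2 => //; lra.
Qed.

Hypothesis Hmin_exists : forall F : {set 'I_d}, exists b, restricted_min Q F b.

Lemma backward_exists st : exists st', foba_backward Q st st'.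
Proof.
move En: #|sF st| => n; elim: n st En => [|n IHn] st En.
  by exists st; apply: bwd_exit; left; apply: cards0_eq.
have [j0 j0F] : exists j, j \in sF st by apply/set0Pn; rewrite -card_gt0 En.
have [j jF jmax] := set_Rargmax (fun j => - Qdrop Q (sbeta st) j) j0F.
have jmin i : i \in sF st -> Qdrop Q (sbeta st) j <= Qdrop Q (sbeta st) i.
  by move/jmax => /=; lra.
have [lt_drop|ge_drop] :=
  Rlt_le_dec (Qdrop Q (sbeta st) j - Q (sbeta st)) (sdelta st #|sF st| / 2).
  have [b bmin] := Hmin_exists (sF st :\ j).
  have [|st' bwd] := IHn (State (sF st :\ j) b (sdelta st)).
    by move: En; rewrite (cardsD1 j) jF => -[].
  by exists st'; apply: (bwd_step jF jmin lt_drop _ _ _ bwd).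
exists st; apply: bwd_exit; right => i /jmin; lra.
Qed.

Variables (r1 p : R).
Hypotheses (HRSC1 : RSC Q g 1 r1 p) (eps0 : 0 < eps).

(** The gradient vanishes on the support, so an entry of size [eps] must lie outside it; in
    particular a full support forces the stopping test. *)
Lemma nonstop_large_gradient st :
  optimal st -> ~ gdt_stop g eps st ->
  exists2 j, j \notin sF st & eps <= Rabs (g (sbeta st) j).
Proof.
move=> opt nstop.
case: (boolP [exists j, if Rle_dec eps (Rabs (g (sbeta st) j)) then true else false]).
  case/existsP=> j; case: Rle_dec => // le_j _; exists j => //.
  apply/negP => jF; move: le_j.
  by rewrite (restricted_min_grad0 HRSC1 opt jF) Rabs_R0; lra.
move/existsPn => small; case: nstop; apply: infnorm_lt => // j.
by have := small j; case: Rle_dec => // gt_eps _; exact: Rnot_le_lt.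
Qed.

Lemma nonstop_iter st :
  optimal st -> ~ gdt_stop g eps st -> exists st', gdt_iter Q g eps st st'.
Proof.
move=> opt nstop; have [j0 j0F _] := nonstop_large_gradient opt nstop.
have [|i iF imax] := @set_Rargmax _ (fun j => Rabs (g (sbeta st) j)) (~: sF st) j0.
  by rewrite inE.
have [b bmin] := Hmin_exists (i |: sF st).
pose st1 := State (i |: sF st) b (fun m => if m == #|i |: sF st| then
  Q (sbeta st) - Q b else sdelta st m).
have [st' bwd] := backward_exists st1.
exists st'; split=> //; exists st1; split=> //; exists i; rewrite inE in iF.
by split=> //; split=> // i' i'F; apply: imax; rewrite inE.
Qed.

Lemma iter_optimal st st' : gdt_iter Q g eps st st' -> optimal st'.
Proof.
by move=> [_ [st1 [[i [_ [_ [_ [opt1 _]]]]] bwd]]]; exact: backward_optimal bwd opt1.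
Qed.

Lemma init_optimal : optimal (init_state d).
Proof.
have E : supp (@vzero d) \subset set0 by exact: subset_supp.
split=> // b b0.
suff eqb (v : vec d) : supp v \subset set0 -> v = vzero.
  by rewrite (eqb _ b0); exact: Rle_refl.
move=> v0; apply: functional_extensionality => j.
by apply: supp_outside v0 _; rewrite inE.
Qed.

Lemma reachable_optimal st : gdt_reachable Q g eps st -> optimal st.
Proof. by case=> [|st0 st1 _ /iter_optimal]; [exact: init_optimal|]. Qed.

Lemma forward_gain_eps st st1 i :
  supp (sbeta st) \subset sF st -> restricted_min Q (i |: sF st) (sbeta st1) ->
  eps <= Rabs (g (sbeta st) i) ->
  eps * eps / (2 * p) <= Q (sbeta st) - Q (sbeta st1).
Proof.
move=> bF min1 le_eps; apply: Rle_trans (forward_gain HRSC1 bF min1).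
have [_ [p0 _]] := HRSC1.
apply: Rmult_le_compat_r; first by left; apply: Rinv_0_lt_compat; lra.
rewrite -[X in _ <= X](Rabs_pos_eq) ?Rabs_mult; last nra.
by nra.
Qed.

Lemma gdt_iter_Acc : Acc (fun st' st => gdt_iter Q g eps st st') (init_state d).
Proof.
have [_ [p0 _]] := HRSC1.
pose c := eps * eps / (2 * p).
have c0 : 0 < c by apply: Rdiv_lt_0_compat; nra.
have [bT [_ minT]] := Hmin_exists [set: 'I_d].
(* As [bT] is a global minimiser, no potential falls below [L]; in [main], [n] bounds the number of
   drops of size [c] that remain. *)
pose L := tail_weight d 0 * Q bT.
have main n st phi : optimal st ->
    chain d c (sdelta st) #|sF st| (Q (sbeta st)) phi ->
    phi - L < INR n * c -> Acc (fun st' st => gdt_iter Q g eps st st') st.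
  elim: n st phi => [|n IHn] st phi opt ch lt_phi.
    have := chain_ge (Rlt_le _ _ c0) ch.
    have := minT (sbeta st) (subsetT _); have := tail_weight_ge0 d 0.
    by move: lt_phi; rewrite /= /L; nra.
  constructor=> st' it; have opt' := iter_optimal it.
  case: it => nstop [st1 [[i [iF [imax [F1 [opt1 D1]]]]] bwd]].
  have [j jF le_j] := nonstop_large_gradient opt nstop.
  have le_i := Rle_trans _ _ _ le_j (imax _ jF).
  have card1 : #|sF st1| = #|sF st|.+1 by rewrite F1 cardsU1 iF.
  have gain : c <= Q (sbeta st) - Q (sbeta st1).
    by apply: forward_gain_eps le_i; rewrite -?F1 //; exact: opt.1.
  have D1E : sdelta st1 #|sF st|.+1 = Q (sbeta st) - Q (sbeta st1).
    by rewrite D1 card1 eqxx.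
  have ch1 : chain d c (sdelta st1) #|sF st1| (Q (sbeta st1))
      (phi - tail_weight d #|sF st1| * (Q (sbeta st) - Q (sbeta st1))).
    rewrite card1; apply: chainS; rewrite ?D1E //; last exact: Rle_refl.
    by apply: eq_chain ch => m mk; rewrite D1 card1; case: eqP => // Em; lia.
  have [phi' ch' le_phi'] := backward_potential c0 bwd opt1 ch1.
  apply: (IHn st' phi') => //.
  (* As the level is at most [d], its tail weight is at least 1, so the forward step lowers the
     potential by at least [c]. *)
  have k1d : (#|sF st1| <= d)%N by rewrite -[X in (_ <= X)%N]card_ord max_card.
  have := tail_weight_ge0 d #|sF st1|.+1; have := tail_weightS k1d.
  by move: lt_phi; rewrite S_INR; nra.
have [n lt_n] := INR_archimed _ (tail_weight d 0 * Q vzero - L) c0.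
apply: (main n _ (tail_weight d 0 * Q vzero)).
- exact: init_optimal.
- by rewrite /= cards0; exact: chain0.
- by [].
Qed.

End Runs.

(** * The bound on the level *)

Section LevelBound.

Variables (d : nat) (Q : vec d -> R) (g : vec d -> vec d).
Hypothesis Hmin_exists : forall F : {set 'I_d}, exists b, restricted_min Q F b.
Variables (bbar : vec d) (s : nat) (r P r1 p eps : R).
Hypotheses (HRSCs : RSC Q g s r P) (HRSC1 : RSC Q g 1 r1 p).
Hypothesis bbar_min : restricted_min Q (supp bbar) bbar.
Notation kbar := (l0 bbar).
Hypothesis Hcond : INR s - INR kbar >
  (INR kbar + 1) * ((sqrt (P / r) + 1) * (2 * p / r)) ^ 2.
Hypothesis Heps : eps > 2 * sqrt 2 * p / r * infnorm (g bbar).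

Lemma eps_gt0 : 0 < eps.
Proof.
have [r0 _] := HRSCs; have [_ [p0 _]] := HRSC1.
apply: Rle_lt_trans Heps; apply: Rmult_le_pos (infnorm_ge0 _).
apply: Rmult_le_pos; last by left; exact: Rinv_0_lt_compat.
by apply: Rmult_le_pos; [have := sqrt_pos 2; lra | lra].
Qed.

Lemma s_gt_kbar : (kbar < s)%N.
Proof.
apply/ltP; apply: INR_lt; have := Hcond; have := pos_INR kbar.
have := pow2_ge_0 ((sqrt (P / r) + 1) * (2 * p / r)); nra.
Qed.

(** [r <= p] makes the squared factor of [Hcond] at least 1. The result feeds the counting
    inequality [ratio] below. *)
Lemma s_sub_kbar_large (j : 'I_d) : (kbar.+1 < s - kbar)%N.
Proof.
have [r0 _] := HRSCs; have [_ [p0 _]] := HRSC1.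
have rp : r <= p := RSC_const_le HRSCs HRSC1 j (leq_ltn_trans (leq0n _) s_gt_kbar).
have q2 : 2 <= 2 * p / r.
  by apply: (Rmult_le_reg_r r) => //; rewrite /Rdiv Rmult_assoc Rinv_l; lra.
have t0 := sqrt_pos (P / r).
apply/ltP; apply: INR_lt; rewrite minus_INR; last by apply/leP/ltnW/s_gt_kbar.
apply: Rle_lt_trans Hcond; rewrite S_INR; have k0 := pos_INR kbar.
have : 1 <= (sqrt (P / r) + 1) * (2 * p / r) by nra.
move: (_ * (2 * p / r)) => z z1.
have z2 : 1 <= z ^ 2 by rewrite -[1](pow1 2); apply: pow_incr; lra.
suff: (INR kbar + 1) * 1 <= (INR kbar + 1) * z ^ 2 by lra.
by apply: Rmult_le_compat_l; lra.
Qed.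

Lemma forward_level_bound st st1 :
  restricted_min Q (sF st) (sbeta st) -> ~ gdt_stop g eps st ->
  gdt_forward Q g st st1 -> #|sF st1| = (s - kbar)%N ->
  ~ (forall i, i \in sF st1 ->
     sdelta st1 #|sF st1| / 2 <= Qdrop Q (sbeta st1) i - Q (sbeta st1)).
Proof.
move=> opt nstop [i [iF [imax [F1 [opt1 D1]]]]] card1 exit1.
have [r0 [P0 _]] := HRSCs; have [_ [p0 _]] := HRSC1.
have eps0 := eps_gt0.
have [j0 j0F le_j0] := nonstop_large_gradient HRSC1 eps0 opt nstop.
set G := Rabs (g (sbeta st) i) in imax.
have geG : eps <= G := Rle_trans _ _ _ le_j0 (imax _ j0F).
set b := sbeta st1 in opt1 D1 exit1; set F := sF st1 in F1 opt1 D1 exit1 card1.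
set B := supp bbar.
have gain : G * G / (2 * p) <= Q (sbeta st) - Q b.
  have -> : G * G = g (sbeta st) i * g (sbeta st) i.
    by rewrite /G -Rabs_mult Rabs_pos_eq //; nra.
  by apply: (forward_gain HRSC1 opt.1); rewrite -F1.
(* The exit test gives delta / 2 <= p b_j^2 / 2, and [gain] gives delta >= G^2 / (2 p). *)
have sq_ge j : j \in F -> G * G / (2 * p * p) <= b j * b j.
  move=> jF; have := exit1 _ jF; rewrite D1 eqxx.
  have := Qdrop_upper HRSC1 opt1 jF => le1 le2.
  have eqG : G * G / (2 * p) = p * (G * G / (2 * p * p)) by field; lra.
  by apply: (Rmult_le_reg_l p) => //; lra.
have ge_abs j : j \in F -> G / (sqrt 2 * p) <= Rabs (b j).
  move=> /sq_ge le_sq; apply: Rsqr_incr_0_var (Rabs_pos _).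
  rewrite -Rsqr_abs /Rsqr; apply: Rle_trans le_sq.
  have s2 := sqrt_sqrt 2 ltac:(lra); have s20 := sqrt_lt_R0 2 ltac:(lra).
  have -> : G / (sqrt 2 * p) * (G / (sqrt 2 * p)) = G * G / (sqrt 2 * sqrt 2 * p * p).
    by field; lra.
  by rewrite s2; lra.
have cardFB : #|F :|: B| = (#|F :\: B| + kbar)%N.
  rewrite cardsU cardsD -/(l0 bbar).
  have : (#|F :&: B| <= #|F|)%N by rewrite subset_leq_card // subsetIl.
  lia.
have card_gt := s_sub_kbar_large i.
have le_n : (#|F :\: B| <= #|F|)%N by rewrite subset_leq_card // subsetDl.
have sFB : (#|F :|: B| <= s)%N by lia.
(* With [eps <= G], the choice of [eps] bounds the gradient at [bbar] by r / 2 times the lower bound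
   in [ge_abs]. *)
have Qge : Q bbar <= Q b.
  apply: (large_entries_value_ge HRSCs HRSC1 bbar_min opt1.1 sFB ge_abs) => j.
  apply: Rle_trans (infnorm_ge _ j) _.
  have s20 := sqrt_lt_R0 2 ltac:(lra).
  have w0 : 0 < r / (2 * (sqrt 2 * p)) by apply: Rdiv_lt_0_compat; nra.
  have -> : r / 2 * (G / (sqrt 2 * p)) = r / (2 * (sqrt 2 * p)) * G by field; lra.
  have -> : infnorm (g bbar) =
      r / (2 * (sqrt 2 * p)) * (2 * sqrt 2 * p / r * infnorm (g bbar)).
    by field; lra.
  by apply: Rmult_le_compat_l; lra.
have [b' opt'] := Hmin_exists (F :|: B).
have [X1 X2] := restricted_min_RSC HRSCs HRSC1 opt'
  (subset_trans opt1.1 (subsetUl F B)) sFB.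
have [Y1 _] := restricted_min_RSC HRSCs HRSC1 opt' (subsetUr F B) sFB.
have F0F : sF st \subset F :|: B.
  by apply: subset_trans (subsetUl F B); rewrite F1 subsetUr.
have gap := greedy_gap HRSCs HRSC1 opt F0F opt'.1 sFB imax.
have Zlow : INR #|F :\: B| * (G * G / (2 * p * p)) <= sqnorm (vsub b bbar).
  apply: sqnorm_ge_card => j; rewrite in_setD => /andP[jB jF].
  by rewrite /vsub (notin_supp jB) Rminus_0_r; exact: sq_ge.
(* Since [Qge] yields |bbar - b'|^2 <= t^2 |b - b'|^2, this weight collapses the triangle bound to
   (1 + t)^2 |b - b'|^2. *)
set t := sqrt (P / r).
have Pr0 : 0 < P / r by exact: Rdiv_lt_0_compat.
have t0 : 0 < t by exact: sqrt_lt_R0.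
have tt : t * t = P / r by apply: sqrt_sqrt; lra.
have Zup := @sqnorm_triangle d t b bbar b' t0.
set m := #|(F :|: B) :\: sF st| in gap.
set n := #|F :\: B| in cardFB le_n Zlow.
have cardF0 : #|F| = #|sF st|.+1 by rewrite F1 cardsU1 iF.
(* [sF st] has s - kbar - 1 elements, whence the successor. *)
have mE : (m + (s - kbar) = n + kbar.+1)%N.
  have := cardsD (F :|: B) (sF st); have := subset_leq_card F0F.
  rewrite -/m (setIidPr F0F) cardFB.
  lia.
have m0 : (0 < m)%N.
  rewrite card_gt0; apply/set0Pn; exists i.
  by rewrite in_setD iF F1 !inE eqxx.
(* With T = s - kbar and K = kbar + 1, substituting m = n + K - T turns this into (n - T) (T - K) <=
   0. *)
have ratio : (m * (s - kbar) <= n * kbar.+1)%N by nia.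
have cond := Hcond.
set S := INR s - INR kbar in cond; set K := INR kbar + 1 in cond.
have K0 : 0 < K by rewrite /K; have := pos_INR kbar; lra.
have ratioR : INR m * S <= INR n * K.
  have -> : S = INR (s - kbar) by rewrite minus_INR //; apply/leP/ltnW/s_gt_kbar.
  by rewrite /K -S_INR -!mult_INR; apply: le_INR; apply/leP.
have n0 : 0 < INR n by apply: lt_0_INR; apply/ltP; nia.
move: X1 X2 Y1 Zlow Zup.
move: (sqnorm (vsub b b')) (sqnorm (vsub bbar b')) (sqnorm (vsub b bbar)).
move=> X Y Z X1 X2 Y1 Zlow Zup.
set W := G * G in gain gap Zlow.
have W0 : 0 < W by rewrite /W; nra.
have W2 : 0 <= W / (2 * p) by left; apply: Rdiv_lt_0_compat; lra.
(* The forward step does not raise [Q], so r X / 2 <= Q b - Q b' <= m W / (2 r). *)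
have XW : r * r * X <= INR m * W.
  have -> : INR m * W = 2 * r * (INR m * (W / (2 * r))) by field; lra.
  have -> : r * r * X = 2 * r * (r / 2 * X) by field.
  by apply: Rmult_le_compat_l; lra.
have ZW : INR n * W <= 2 * p * p * Z.
  have -> : INR n * W = 2 * p * p * (INR n * (W / (2 * p * p))) by field; lra.
  by apply: Rmult_le_compat_l; nra.
have YX : Y <= t * t * X.
  rewrite tt; apply: (Rmult_le_reg_l (r / 2)); first lra.
  have -> : r / 2 * (P / r * X) = P / 2 * X by field; lra.
  lra.
have ZX : Z <= (t + 1) * (t + 1) * X.
  have -> : (t + 1) * (t + 1) * X = (1 + t) * X + (1 + / t) * (t * t * X).
    by field; lra.
  have t'0 := Rinv_0_lt_compat _ t0.
  have := @Rmult_le_compat_l (1 + / t) _ _ ltac:(lra) YX; lra.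
have nW0 := Rmult_lt_0_compat _ _ n0 W0.
have pp : 0 < 2 * p * p by nra.
have X0 : 0 < X.
  have Z0 : 0 < Z by nra.
  by nra.
have Sr : K * (4 * ((t + 1) * (t + 1)) * (p * p)) < S * (r * r).
  have rr : 0 < r * r by nra.
  have := Rmult_lt_compat_r _ _ _ rr cond; rewrite -/t; congr (_ < _).
  by field; lra.
(* With A = K p^2 (t + 1)^2 X > 0, the chain is 4 A < S r^2 X <= S m W <= K n W <= 2 p^2 K Z <= 2 A,
   which is absurd. *)
have c1 := Rmult_lt_compat_r _ _ _ X0 Sr.
have S0 : 0 <= S.
  by apply: Rlt_le; apply: Rle_lt_trans cond; apply: Rmult_le_pos (pow2_ge_0 _); lra.
have c2 := Rmult_le_compat_l _ _ _ S0 XW.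
have c3 := Rmult_le_compat_r _ _ _ (Rlt_le _ _ W0) ratioR.
have c4 := Rmult_le_compat_l _ _ _ (Rlt_le _ _ K0) ZW.
have c5 := Rmult_le_compat_l _ _ _ (Rlt_le _ _ (Rmult_lt_0_compat _ _ K0 pp)) ZX.
have c6 : 0 < K * (p * p) * ((t + 1) * (t + 1)) * X.
  by apply: Rmult_lt_0_compat => //; apply: Rmult_lt_0_compat; nra.
lra.
Qed.

(** The level rises by at most one per iteration, so reaching [s - kbar] would require leaving the
    backward step immediately after the forward step, which [forward_level_bound] excludes. *)
Lemma reachable_level_bound st :
  gdt_reachable Q g eps st -> (#|sF st| < s - kbar)%N.
Proof.
elim=> [|st0 st' reach0 lt0 [nstop [st1 [fwd bwd]]]].
  by rewrite /= cards0 subn_gt0 s_gt_kbar.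
have opt0 := reachable_optimal reach0.
have card1 : #|sF st1| = #|sF st0|.+1.
  by have [i [iF [_ [-> _]]]] := fwd; rewrite cardsU1 iF.
case: bwd card1 fwd => [st2 ex|st2 j st3 st4 jF _ _ F3 _ _ bwd] card1 fwd; last first.
  have := backward_card bwd.
  have : #|sF st2| = #|sF st3|.+1 by rewrite F3 (cardsD1 j) jF.
  lia.
rewrite ltn_neqAle card1 lt0 andbT; apply/negP => /eqP E.
case: ex => [F0|]; first by rewrite F0 cards0 in card1.
by apply: forward_level_bound fwd _ => //; rewrite card1.
Qed.

End LevelBound.

Theorem theorem2 (d : nat) (Q : vec d -> R) (g : vec d -> vec d)
  (HQconv : convex Q) (HQC1 : is_C1_gradient Q g)
  (Hmin_exists : forall F : {set 'I_d}, exists b, restricted_min Q F b)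
  (bbar : vec d) (kbar : nat)
  (Hkbar : l0 bbar = kbar)
  (Hbbar : forall b : vec d, (l0 b <= kbar)%N -> Q bbar <= Q b)
  (s : nat) (Hs : (0 < s)%N)
  (rm_s rp_s rm_1 rp_1 : R)
  (HRSCs : RSC Q g s rm_s rp_s) (HRSC1 : RSC Q g 1 rm_1 rp_1)
  (Hcond : INR s - INR kbar >
           (INR kbar + 1) * ((sqrt (rp_s / rm_s) + 1) * (2 * rp_1 / rm_s)) ^ 2)
  (eps : R)
  (Heps : eps > 2 * sqrt 2 * rp_1 / rm_s * infnorm (g bbar)) :
  (* the run cannot go on forever *)
  Acc (fun st' st => gdt_iter Q g eps st st') (init_state d) /\
  (* it never gets stuck without the stopping test holding *)
  (forall st, gdt_reachable Q g eps st -> ~ gdt_stop g eps st ->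
     exists st', gdt_iter Q g eps st st') /\
  (* whenever it stops, it stops at k <= s - kbar *)
  (forall st, gdt_reachable Q g eps st -> gdt_stop g eps st ->
     (#|sF st| <= s - kbar)%N).
Proof.
have bbar_min : restricted_min Q (supp bbar) bbar.
  split=> // b bB; apply: Hbbar; rewrite -Hkbar; exact: subset_leq_card.
rewrite -Hkbar in Hcond *.
have eps0 := eps_gt0 HRSCs HRSC1 Heps.
split; first exact (gdt_iter_Acc Hmin_exists HRSC1 eps0).
split=> st reach.
  exact (nonstop_iter Hmin_exists HRSC1 eps0 (reachable_optimal reach)).
by move=> _; apply: ltnW;
   exact: (reachable_level_bound Hmin_exists HRSCs HRSC1 bbar_min Hcond Heps).
Qed.
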